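(* Let $K$ be a simplicial complex on $[m]$ with vertices $v_1,\dots,v_m$ and $K_1,\dots,K_m$ simplicial complexes on $[n_1],\dots,[n_m]$; let $i\in[m]$ and $n\ge1$. If $K_i$ has a non-trivial $Sq^n$ and $\mathrm{link}_K(v_i)$ is not acyclic, then the substitution complex $K\langle K_1,\ldots,K_m\rangle$ has a non-trivial $Sq^n$ (propagating from $K_i$).
   Context: $H^*(-)$ denotes cohomology with $\mathbb F_2$ coefficients throughout; acyclic means that the reduced cohomology with $\mathbb F_2$ coefficients vanishes (for the complex $\{\emptyset\}$, reduced cohomology is $\mathbb F_2$ in degree $-1$). A simplicial complex $L$ ''has a non-trivial $Sq^n$'' if the Steenrod square $Sq^n\colon H^*(L)\to H^{*+n}(L)$ is non-zero (cohomology of the geometric realization). ''Propagation'' refers to the situation in which the existence of a non-trivial Steenrod operation on a substitution complex is deduced from the existence of such an operation on one of the complexes used to build it. A simplicial complex on $[m]=\{1,\dots,m\}$ contains $\emptyset$ and has vertices labelled by $[m]$. $\mathrm{link}_K(v)=\{\tau\in K\mid v\notin\tau,\ \tau\cup\{v\}\in K\}$. For $K$ on $[m]$ and $K_i$ on $[n_i]$, the substitution complex $K\langle K_1,\ldots,K_m\rangle$ is the polyhedral join $(K_i,\emptyset)^{*K}$, i.e. the simplicial complex on vertices $v_{i,j}$ ($i\in[m]$, $j\in[n_i]$) whose simplices are exactly the joins (disjoint unions) $\tau_{i_1}*\cdots*\tau_{i_k}$ with $\{i_1,\dots,i_k\}\in K$ and $\tau_{i_j}\in K_{i_j}$, where the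 vertices of $K_i$ are identified with $v_{i,1},\dots,v_{i,n_i}$. *)

(* Defs.v *)
From HB Require Import structures.
From mathcomp Require Import all_boot all_order all_algebra.

Set Implicit Arguments.
Unset Strict Implicit.
Unset Printing Implicit Defensive.

Import GRing.Theory.
Local Open Scope ring_scope.

(* An element x of V with [set x] \notin K is allowed ("ghost vertex").  When
   every element of V is a vertex of K, "K has a vertex" just means that V is
   not empty. *)
Record scomplex (V : finType) := SComplex {
  faces :> {set {set V}};
  faces0 : set0 \in faces;
  faces_sub : forall s t : {set V}, s \in faces -> t \subset s -> t \in faces }.

(* A bare set of sets rather than an scomplex, since it does not contain the
   empty simplex when v is a ghost vertex of K. *)
Definition link (V : finType) (K : scomplex V) (v : V) : {set {set V}} :=
  [set t : {set V} | (t \in K) && (v \notin t) && (v |: t \in K)].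

Section Substitution.
Variables (m : nat) (d : 'I_m -> nat).
Variables (K : scomplex 'I_m) (L : forall i, scomplex 'I_(d i)).

(* The vertex v_{i,j} is Tagged _ j, with tag i. *)
Definition subst_vertex : finType := {i : 'I_m & 'I_(d i)}.

Definition subst_faces : {set {set subst_vertex}} :=
  [set s : {set subst_vertex} |
    [exists I in faces K, exists tau : {dffun forall i, {set 'I_(d i)}},
      [forall i in I, tau i \in L i] &&
      (s == \bigcup_(i in I)
              [set (Tagged (fun i => 'I_(d i)) j : subst_vertex)
                | j in tau i])]].

Lemma subst_faces0 : set0 \in subst_faces.
Proof.
rewrite inE; apply/existsP; exists set0; rewrite faces0 /=.
apply/existsP; exists [ffun i => set0]; apply/andP; split.
  by apply/forallP => i; rewrite inE.
by rewrite big_set0.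
Qed.

Lemma subst_faces_sub (s t : {set subst_vertex}) :
  s \in subst_faces -> t \subset s -> t \in subst_faces.
Proof.
rewrite !inE => /existsP[I /andP[KI /existsP[tau /andP[/forallP Ltau /eqP ->]]]].
move=> /subsetP ts; apply/existsP; exists I; rewrite KI /=; apply/existsP.
exists [ffun i => [set j in tau i | (Tagged (fun i => 'I_(d i)) j : subst_vertex) \in t]].
apply/andP; split.
  apply/forallP => i; apply/implyP => iI; rewrite ffunE.
  apply: faces_sub (implyP (Ltau i) iI) _.
  by apply/subsetP => j; rewrite inE => /andP[].
apply/eqP/setP => x; apply/idP/bigcupP => [xt|[i iI /imsetP[j]]].
  have /bigcupP[i iI /imsetP[j jt xE]] := ts _ xt.
  by exists i => //; apply/imsetP; exists j => //; rewrite ffunE inE jt -xE.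
by rewrite ffunE inE => /andP[_ jt] ->.
Qed.

Definition substitution : scomplex subst_vertex :=
  SComplex subst_faces0 subst_faces_sub.

End Substitution.

(* Simplicial cohomology with F_2 coefficients, computed from the ordered
   cochain complex: cochains on all tuples of vertices (repetitions allowed)
   that span a simplex.  This needs no choice of a total order of the vertices
   and is contravariant in arbitrary simplicial maps. *)
Section Cohomology.
Variables (V : finType) (X : {set {set V}}).

(* k vertices, hence dimension k - 1; the case k = 0 is the empty simplex. *)
Definition osimplex (k : nat) : finType :=
  {t : k.-tuple V | [set v in tval t] \in X}.

Definition cochain (k : nat) := {ffun osimplex k -> 'F_2}.

(* The value of x on s, or 0 if s does not have length k or does not span a
   simplex of X. *)
Definition ev (k : nat) (x : cochain k) (s : seq V) : 'F_2 :=
  oapp x 0 (obind insub (insub s : option (k.-tuple V))).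

(* The subsequence of t at the positions in A (enumerated increasingly). *)
Definition subtuple (l : nat) (t : l.-tuple V) (A : {set 'I_l}) : seq V :=
  [seq tnth t p | p <- enum A].

Definition delta (k : nat) (x : cochain k) : cochain k.+1 :=
  [ffun t => \sum_(p < k.+1) ev x (subtuple (val t) [set~ p])].

(* The positions J = {j_0 < ... < j_i} cut 0, ..., l - 1 into the intervals
   [0, j_0], [j_0, j_1], ..., [j_i, l - 1], which overlap in J;  cut b J is the
   union of the intervals of even rank (b = false) or of odd rank (b = true). *)
Definition cut (l : nat) (b : bool) (J : {set 'I_l}) : {set 'I_l} :=
  [set p | (p \in J) || (odd #|[set j in J | (j < p)%N]| == b)].

(* Steenrod's cup-i product.  With deg x = j - 1 and deg y = k - 1 it has degree
   j + k - i - 2, i.e. it is meant to be used with l = j + k - i - 1 (and it is 0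
   otherwise).  By definition of ev, the only terms that count are those in
   which the two subsequences have lengths j and k. *)
Definition cup (i j k l : nat) (x : cochain j) (y : cochain k) : cochain l :=
  [ffun t => \sum_(J : {set 'I_l} | #|J| == i.+1)
     ev x (subtuple (val t) (cut false J)) *
     ev y (subtuple (val t) (cut true J))].

(* Sq^n on a q-cocycle x is represented by the cup-(q - n) product of x with
   itself, and it is 0 if n > q. *)
Definition sq (n q : nat) (x : cochain q.+1) : cochain (q + n).+1 :=
  if (n <= q)%N then cup (q - n) (q + n).+1 x x else 0.

(* Coboundaries in the non-augmented complex. *)
Definition coboundary (q : nat) : cochain q.+1 -> Prop :=
  match q with
  | 0 => fun x => x = 0
  | q'.+1 => fun x => exists w : cochain q'.+1, x = delta w
  end.

Definition has_nontrivial_sq (n : nat) : Prop :=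
  exists (q : nat) (x : cochain q.+1),
    delta x = 0 /\ ~ coboundary (sq n x).

(* Vanishing of reduced cohomology, i.e. exactness of the augmented complex;
   the first clause is degree -1. *)
Definition acyclic : Prop :=
  (forall x : cochain 0, delta x = 0 -> x = 0) /\
  (forall k (x : cochain k.+1), delta x = 0 -> exists w : cochain k, x = delta w).

End Cohomology.

(* Main.v *)
(** Let x be a q-cocycle of L i with Sq^n x <> 0, and c a reduced cocycle of
    link K i that is not a coboundary; the join of the two complexes lies inside
    the substitution complex.  The cochain z (t) = x (t') c (t''), where t' is the
    part of the tuple t with tag i and t'' lists the tags of the other vertices,
    is a cocycle on the whole substitution complex, because a simplex with a
    vertex of tag i projects to the star of i.  On a concatenation s t of a
    tuple s of L i and a lift of a tuple t of the link, Steenrod's formula gives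
    (Sq^n z) (s t) = (Sq^n x) (s) c (t) exactly.  If Sq^n z were the coboundary
    of f, then applying to the variable t a linear form that kills coboundaries
    and sends c to 1 would exhibit Sq^n x as a coboundary. *)

From HB Require Import structures.
Require Import Defs.
From mathcomp Require Import all_boot all_order all_algebra.
From Stdlib Require Import Classical_Prop.

Set Implicit Arguments.
Unset Strict Implicit.
Unset Printing Implicit Defensive.

Import GRing.Theory.
Local Open Scope ring_scope.

(** * The coboundary formula on functions of sequences *)

(** The ordered coboundary modulo 2, for functions of all sequences: no lengths or simplices to
    carry, and the recursion makes product rules provable by induction. *)
Fixpoint dif (V : Type) (f : seq V -> 'F_2) (s : seq V) : 'F_2 :=
  if s is a :: s' then f s' + dif (fun u => f (a :: u)) s' else 0.

Lemma difE (V : Type) (f : seq V -> 'F_2) (s : seq V) :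
  dif f s = \sum_(p < size s) f (take p s ++ drop p.+1 s).
Proof.
elim: s f => [|a s IH] f; first by rewrite big_ord0.
by rewrite big_ord_recl /= drop0 IH.
Qed.

Lemma eq_dif (V : Type) (P : pred V) (f g : seq V -> 'F_2) (s : seq V) :
  (forall u, all P u -> (size u).+1 = size s -> f u = g u) ->
  all P s -> dif f s = dif g s.
Proof.
elim: s f g => [|a s IH] f g //= fg /andP[Pa Ps].
rewrite fg //; congr (_ + _); apply: IH => // u Pu us.
by apply: fg; rewrite /= ?Pa // us.
Qed.

Lemma dif_eq0 (V : eqType) (f : seq V -> 'F_2) (s : seq V) :
  (forall u, (size u).+1 = size s -> f u = 0) -> dif f s = 0.
Proof.
move=> f0; rewrite (@eq_dif _ predT f (fun=> 0)) ?all_predT //; last first.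
  by move=> u _; apply: f0.
by elim: (s) => //= a s' ->; rewrite addr0.
Qed.

Lemma dif_cat (V : Type) (f : seq V -> 'F_2) (s t : seq V) :
  dif f (s ++ t) = dif (fun u => f (u ++ t)) s + dif (fun u => f (s ++ u)) t.
Proof. by elim: s f => [|a s IH] f /=; rewrite ?add0r // IH addrA. Qed.

Lemma dif_map (V W : Type) (h : V -> W) (f : seq W -> 'F_2) (s : seq V) :
  dif f (map h s) = dif (fun u => f (map h u)) s.
Proof. by elim: s f => //= a s IH f; rewrite IH. Qed.

(** Each entry of [s] feeds exactly one of the two factors, so omitting it changes that factor only;
    modulo 2 the interleaving brings no sign. *)
Lemma dif_unshuffle (V A B : Type) (a : V -> option A) (b : V -> option B)
    (F : seq A -> 'F_2) (G : seq B -> 'F_2) (s : seq V) :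
  (forall v, isSome (a v) = ~~ isSome (b v)) ->
  dif (fun u => F (pmap a u) * G (pmap b u)) s =
  dif F (pmap a s) * G (pmap b s) + F (pmap a s) * dif G (pmap b s).
Proof.
move=> ab; elim: s F G => [|v s IH] F G /=; first by rewrite mul0r mulr0 addr0.
move: (ab v); case: (a v) (b v) => [x|] [y|] //= _.
  by rewrite (IH (fun u => F (x :: u))) mulrDl addrA.
by rewrite (IH F (fun u => G (y :: u))) mulrDr addrCA.
Qed.

Lemma size_unshuffle (V A B : Type) (a : V -> option A) (b : V -> option B)
    (s : seq V) : (forall v, isSome (a v) = ~~ isSome (b v)) ->
  (size (pmap a s) + size (pmap b s))%N = size s.
Proof.
move=> ab; rewrite !size_pmap -(count_predC (fun v => isSome (b v))) addnC.
by congr (_ + _)%N; apply: eq_count => v /=; rewrite ab.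
Qed.

(** * Cochains evaluated on sequences *)

Lemma subtupleE (V : finType) (l : nat) (t : l.-tuple V) (A : {set 'I_l}) :
  subtuple t A = mask [seq p \in A | p <- enum 'I_l] t.
Proof.
rewrite /subtuple -[in RHS](map_tnth_enum t) -map_mask -filter_mask.
by rewrite {1}/enum_mem -enumT.
Qed.

Lemma subtuple_setC1 (V : finType) (l : nat) (t : l.-tuple V) (p : 'I_l) :
  subtuple t [set~ p] = take p t ++ drop p.+1 t.
Proof.
rewrite subtupleE.
(* The summand [0] is the start of the [iota] range; the induction generalises both, since passing
   to the tail shifts positions. *)
have -> : [seq r \in [set~ p] | r <- enum 'I_l]
        = [seq r != p + 0 | r <- iota 0 (size t)]%N.
  rewrite addn0 size_tuple -val_enum_ord -[RHS]map_comp.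
  by apply: eq_map => r /=; rewrite !inE.
elim: (tval t) (nat_of_ord p) 0%N => [|a s IH] [|k] j //=.
  rewrite eqxx /= drop0 add0n.
  have -> : [seq r != j | r <- iota j.+1 (size s)] = nseq (size s) true.
    set m := map _ _; have /all_pred1P -> : all (pred1 true) m.
      by rewrite all_map; apply/allP => r; rewrite mem_iota /= => /andP[/gtn_eqF->].
    by rewrite size_map size_iota.
  by rewrite mask_true.
rewrite -{1}[j]add0n eqn_add2r /=; congr (_ :: _).
by rewrite addSnnS IH.
Qed.

Section Evaluation.
Variables (V : finType) (X : {set {set V}}).

Lemma ev_val (k : nat) (x : cochain X k) (t : osimplex X k) :
  ev x (val (val t)) = x t.
Proof. by rewrite /ev valK /= valK. Qed.

Lemma ev_size (k : nat) (x : cochain X k) (s : seq V) :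
  size s != k -> ev x s = 0.
Proof. by rewrite /ev => sk; rewrite insubN. Qed.

Lemma osimplexP (k : nat) (s : seq V) :
  size s = k -> [set v in s] \in X -> exists t : osimplex X k, s = val (val t).
Proof.
move=> /eqP sk sX; have tX : [set v in tval (Tuple sk)] \in X by [].
by exists (exist _ (Tuple sk) tX).
Qed.

Lemma ev_ffun (k : nat) (f : seq V -> 'F_2) (s : seq V) :
  size s = k -> [set v in s] \in X ->
  ev [ffun t : osimplex X k => f (val (val t))] s = f s.
Proof.
by move=> sk sX; have [t ->] := osimplexP sk sX; rewrite ev_val ffunE.
Qed.

Lemma ev0 (k : nat) (s : seq V) : ev (0 : cochain X k) s = 0.
Proof.
by rewrite /ev; case: insubP => //= t _ _; case: insubP => //= u _ _; rewrite ffunE.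
Qed.

Lemma ev_linear (k : nat) (a : 'F_2)
    (x y : {ffun osimplex X k -> ('F_2)^o}) (s : seq V) :
  ev (a *: x + y : cochain X k) s = a * ev x s + ev y s.
Proof.
rewrite /ev; case: insubP => /= [t _ _|_]; last by rewrite mulr0 addr0.
by case: insubP => /= [u _ _|_]; rewrite ?ffunE // mulr0 addr0.
Qed.

Lemma ev_delta (k : nat) (x : cochain X k) (s : seq V) :
  size s = k.+1 -> [set v in s] \in X -> ev (delta x) s = dif (ev x) s.
Proof.
move=> sk sX; have [t ->] := osimplexP sk sX; rewrite ev_val ffunE difE.
rewrite size_tuple; apply: eq_bigr => p _.
by rewrite subtuple_setC1.
Qed.

Lemma delta_is_linear (k : nat) :
  linear (@delta V X k : {ffun _ -> ('F_2)^o} -> {ffun _ -> ('F_2)^o}).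
Proof.
move=> a x y; apply/ffunP => t; rewrite !ffunE.
under eq_bigr => p _ do rewrite ev_linear.
by rewrite big_split -big_distrr.
Qed.

Lemma cochainP (k : nat) (x y : cochain X k) :
  (forall s, size s = k -> [set v in s] \in X -> ev x s = ev y s) -> x = y.
Proof.
move=> xy; apply/ffunP => t; rewrite -!ev_val; apply: xy; last exact: (valP t).
by rewrite size_tuple.
Qed.

(** On lengths other than [k.+1] every term vanishes, because [ev] is 0 on sequences of the wrong
    length. *)
Lemma dif_ev_cocycle (k : nat) (x : cochain X k) (s : seq V) :
  delta x = 0 -> [set v in s] \in X -> dif (ev x) s = 0.
Proof.
move=> dx sX; have [sk|sk] := eqVneq (size s) k.+1.
  by rewrite -ev_delta // dx; have [t ->] := osimplexP sk sX; rewrite ev_val ffunE.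
by apply: dif_eq0 => u us; apply: ev_size; rewrite -eqSS us.
Qed.

Hypothesis XP : forall s t : {set V}, s \in X -> t \subset s -> t \in X.

Lemma dif_ev_ffun (k : nat) (f : seq V -> 'F_2) (s : seq V) :
  size s = k.+1 -> [set v in s] \in X ->
  dif (ev [ffun t : osimplex X k => f (val (val t))]) s = dif f s.
Proof.
move=> sk sX; apply: (@eq_dif _ (mem s)); last by apply/allP.
move=> u /allP us /eqP; rewrite sk eqSS => /eqP uk; apply: ev_ffun => //.
by apply: XP sX _; apply/subsetP => v; rewrite !inE => /us.
Qed.

(** The values of [f] off the simplices do not matter, as [X] is closed under subsets. Degree 0 is
    different: there [dif f] yields constants, whereas [coboundary] admits only 0. *)
Lemma coboundary_dif (q : nat) (x : cochain X q.+1) : (0 < q)%N ->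
  coboundary x <->
  exists f : seq V -> 'F_2, forall s, size s = q.+1 -> [set v in s] \in X ->
    ev x s = dif f s.
Proof.
case: q x => // q x _; split=> [[w ->]|[f xf]].
  by exists (ev w) => s sq sX; rewrite ev_delta.
exists [ffun t => f (val (val t))]; apply: cochainP => s sq sX.
by rewrite ev_delta // dif_ev_ffun // xf.
Qed.

End Evaluation.

(** * Linear forms over F_2 *)

(** Projecting along [U] onto a complement sends [v] to a nonzero vector; the form reads off one of
    its nonzero coordinates, which over F_2 equals 1. *)
Lemma separating_functional (T : finType) (U : {vspace {ffun T -> ('F_2)^o}})
    (v : {ffun T -> ('F_2)^o}) : v \notin U ->
  exists eta : {scalar {ffun T -> ('F_2)^o}},
    (forall u, u \in U -> eta u = 0) /\ eta v = 1.
Proof.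
move=> vU; pose phi := (\1 - projv U)%VF.
have phiE u : phi u = u - projv U u by rewrite add_lfunE opp_lfunE id_lfunE.
have [t phit] : exists t, phi v t != 0.
  apply/existsP; apply: contraR vU => /existsPn phi0.
  have /eqP : phi v = 0 by apply/ffunP => t; rewrite ffunE; apply/eqP/negPn/phi0.
  by rewrite phiE subr_eq0 => /eqP ->; apply: memv_proj.
have lin : scalar (fun u => phi u t).
  by move=> a u w; rewrite linearP !ffunE.
pose eta0 := GRing.isLinear.Build _ _ _ _ _ lin.
pose eta : {scalar {ffun T -> ('F_2)^o}} := HB.pack (fun u => phi u t) eta0.
exists eta; split=> [u uU|] /=.
  by rewrite /eta /= phiE projv_id // subrr ffunE.
by rewrite /eta /=; move: (phi v t) phit => [[|[|]]] //= ? _; apply: val_inj.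
Qed.

(** * Steenrod's cup-i product in terms of boolean masks *)

(* Reads [cut] off the indicator of J: [par] is the parity of the number of
   elements of J passed so far. *)
Fixpoint cut_mask (par b : bool) (m : bitseq) : bitseq :=
  if m is a :: m' then (a || (par == b)) :: cut_mask (par (+) a) b m' else [::].

Lemma size_cut_mask (par b : bool) (m : bitseq) :
  size (cut_mask par b m) = size m.
Proof. by elim: m par => //= a m IH par; rewrite IH. Qed.

Lemma cut_mask_cat (par b : bool) (m1 m2 : bitseq) :
  cut_mask par b (m1 ++ m2) =
  cut_mask par b m1 ++ cut_mask (par (+) odd (count id m1)) b m2.
Proof.
elim: m1 par => [|a m1 IH] par /=; first by rewrite addbF.
by rewrite IH oddD addbA; case: a.
Qed.

Lemma cut_mask_nseq (par b : bool) (l : nat) :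
  cut_mask par b (nseq l true) = nseq l true.
Proof. by elim: l par => //= l IH par; rewrite IH. Qed.

Lemma nth_cut_mask (par b : bool) (m : bitseq) (p : nat) : (p < size m)%N ->
  nth false (cut_mask par b m) p =
  nth false m p || (par (+) odd (count id (take p m)) == b).
Proof.
elim: m par p => [|a m IH] par [|p] //= pm; first by rewrite addbF.
by rewrite IH // oddD addbA; case: a.
Qed.

(** The even and the odd intervals meet only in J, so a position kept by both masks belongs to J. *)
Lemma cut_maskI (par : bool) (m : bitseq) :
  all id (cut_mask par false m) -> all id (cut_mask par true m) -> all id m.
Proof.
elim: m par => //= a m IH par /andP[h1 m1] /andP[h2 m2].
by rewrite (IH _ m1 m2) andbT; case: (a) (par) h1 h2 => [] [].
Qed.

Lemma cutE (l : nat) (b : bool) (J : {set 'I_l}) :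
  [seq p \in cut b J | p <- enum 'I_l] =
  cut_mask false b [seq p \in J | p <- enum 'I_l].
Proof.
have szE (A : {set 'I_l}) : size [seq p \in A | p <- enum 'I_l] = l.
  by rewrite size_map size_enum_ord.
apply: (@eq_from_nth _ false) => [|k]; first by rewrite size_cut_mask !szE.
rewrite szE => kl; rewrite nth_cut_mask ?szE //.
pose p := Ordinal kl.
have nthE (A : {set 'I_l}) : nth false [seq q \in A | q <- enum 'I_l] k = (p \in A).
  by rewrite (nth_map p) ?size_enum_ord // (nth_ord_enum p p : nth p _ k = p).
rewrite !nthE.
rewrite inE addFb; congr (_ || (odd _ == b)).
rewrite -map_take count_map cardE -size_filter /enum_mem.
have -> : take k (enum 'I_l) = filter (fun j : 'I_l => (j < k)%N) (enum 'I_l).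
  apply: (inj_map val_inj); rewrite map_take val_enum_ord.
  rewrite (@eq_filter _ _ (preim val (fun j => j < k)%N)) // -filter_map.
  rewrite val_enum_ord take_iota (minn_idPl (ltnW kl)).
  by rewrite -(filter_iota_ltn 0 (ltnW kl)).
rewrite -filter_predI; congr size; rewrite -enumT.
by apply: eq_filter => j; rewrite !inE.
Qed.

(** Boolean sequences stand for the subsets J, so that a sum over the positions of a concatenation
    splits into a double sum. *)
Definition masks (l : nat) : seq bitseq := [seq val m | m : l.-tuple bool].

Lemma mem_masks (l : nat) (m : bitseq) : (m \in masks l) = (size m == l).
Proof.
apply/imageP/eqP => [[t _ ->]|/eqP ml]; first by rewrite size_tuple.
by exists (Tuple ml).
Qed.

Lemma masks_uniq (l : nat) : uniq (masks l).
Proof. by rewrite map_inj_uniq ?enum_uniq //; apply: val_inj. Qed.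

Lemma masks_cat (k l : nat) :
  perm_eq (masks (k + l)) [seq m1 ++ m2 | m1 <- masks k, m2 <- masks l].
Proof.
apply: uniq_perm; first exact: masks_uniq.
  apply: allpairs_uniq; try exact: masks_uniq.
  move=> [m1 m2] [m3 m4] /allpairsP[[? ?] /= [h1 h2 [-> ->]]].
  move=> /allpairsP[[? ?] /= [h3 h4 [-> ->]]] /eqP.
  move: h1 h3; rewrite !mem_masks => /eqP h1 /eqP h3.
  by rewrite eqseq_cat ?h1 ?h3 // => /andP[/eqP -> /eqP ->].
move=> m; rewrite mem_masks; apply/idP/allpairsP => [/eqP ml|[[m1 m2] /= []]].
  exists (take k m, drop k m); rewrite /= !mem_masks cat_take_drop size_drop ml.
  by rewrite addKn size_takel ?ml ?leq_addr.
by rewrite !mem_masks => /eqP h1 /eqP h2 ->; rewrite size_cat h1 h2.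
Qed.

Lemma masks_set (l : nat) :
  perm_eq (masks l) [seq [seq p \in J | p <- enum 'I_l] | J : {set 'I_l}].
Proof.
apply: uniq_perm; first exact: masks_uniq.
  rewrite map_inj_uniq ?enum_uniq // => J1 J2 /eq_in_map J12.
  by apply/setP => p; apply: J12; rewrite mem_enum.
move=> m; rewrite mem_masks; apply/eqP/imageP => [ml|[J _ ->]]; last first.
  by rewrite size_map size_enum_ord.
exists [set p : 'I_l | nth false m p] => //.
rewrite (@eq_map _ _ _ (nth false m \o val)) => [|p /=]; last by rewrite inE.
by rewrite map_comp val_enum_ord -ml map_nth_iota0 ?take_size.
Qed.

Lemma ev_cup (V : finType) (X : {set {set V}}) (i j k l : nat)
    (x : cochain X j) (y : cochain X k) (s : seq V) :
  size s = l -> [set v in s] \in X ->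
  ev (cup i l x y) s =
  \sum_(m <- masks l | count id m == i.+1)
    ev x (mask (cut_mask false false m) s) * ev y (mask (cut_mask false true m) s).
Proof.
move=> sl sX; have [t ->] := osimplexP sl sX; rewrite ev_val ffunE.
rewrite (perm_big _ (masks_set l)) big_map big_enum_cond /=.
apply: eq_big => [J|J _]; last by rewrite !subtupleE !cutE.
by rewrite count_map cardE size_filter -[Finite.enum _]enumT.
Qed.

(** * Slant product with a linear form *)

Section Slant.
Variables (V W : finType) (X : {set {set V}}) (Y : {set {set W}}) (l : nat).
Variable eta : {scalar {ffun osimplex Y l -> ('F_2)^o}}.

Lemma slant_dif (f : seq V -> seq W -> 'F_2) (s : seq V) :
  eta [ffun t => dif (fun u => f u (val (val t))) s] =
  dif (fun u => eta [ffun t => f u (val (val t))]) s.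
Proof.
elim: s f => [|a s IH] f /=.
  by rewrite -[RHS](linear0 eta); congr (eta _); apply/ffunP => t; rewrite !ffunE.
rewrite -(IH (fun u => f (a :: u))) -linearD; congr (eta _).
by apply/ffunP => t; rewrite !ffunE.
Qed.

(** Apply [eta] in the variable [t]: it sends [c] to 1, kills [dif (f s) t], and commutes with the
    difference in [s]. *)
Lemma slant_coboundary (k : nat) (a : seq V -> 'F_2) (c : cochain Y l)
    (f : seq V -> seq W -> 'F_2) :
  (forall g : seq W -> 'F_2, eta [ffun t => dif g (val (val t))] = 0) ->
  eta c = 1 ->
  (forall s t, size s = k -> [set v in s] \in X ->
     size t = l -> [set w in t] \in Y ->
     a s * ev c t = dif (fun u => f u t) s + dif (f s) t) ->
  exists g : seq V -> 'F_2, forall s, size s = k -> [set v in s] \in X ->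
    a s = dif g s.
Proof.
move=> eta0 etac acf; exists (fun u => eta [ffun t => f u (val (val t))]).
move=> s sk sX; rewrite -slant_dif.
rewrite -[RHS]addr0 -(eta0 (f s)) -linearD.
transitivity (eta (a s *: (c : {ffun osimplex Y l -> ('F_2)^o}))).
  by rewrite linearZ /= etac; apply/esym/mulr1.
congr (eta _); apply/ffunP => t; rewrite !ffunE -acf //.
- by rewrite ev_val.
- by rewrite size_tuple.
- exact: (valP t).
Qed.

End Slant.

(** * Simplices of the link and of the substitution complex *)

Lemma link_sub (V : finType) (K : scomplex V) (v : V) (s t : {set V}) :
  s \in link K v -> t \subset s -> t \in link K v.
Proof.
rewrite !inE => /andP[/andP[sK vs] vK] ts.
rewrite (faces_sub sK ts) (faces_sub vK) ?setUS // !andbT.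
by apply: contra vs => /(subsetP ts).
Qed.

Section Propagation.
Variables (m : nat) (d : 'I_m -> nat).
Variables (K : scomplex 'I_m) (L : forall j, scomplex 'I_(d j)) (i : 'I_m).

Local Notation V := (subst_vertex d).
Local Notation vertex x := (Tagged (fun j => 'I_(d j)) x : V).

(** With its converse [mem_substitution], this describes simplices by their projection to [K] and
    their fibres, in place of the witnesses [I] and [tau]. *)
Lemma substitutionP (s : {set V}) :
  s \in faces (substitution K L) ->
  ([set tag v | v in s] \in faces K) /\
  forall j, [set x | vertex (x : 'I_(d j)) \in s] \in faces (L j).
Proof.
rewrite inE => /existsP[I /andP[KI /existsP[tau /andP[/forallP Ltau /eqP ->]]]].
split.
  apply: faces_sub KI _; apply/subsetP => j /imsetP[v /bigcupP[j' j'I]].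
  by move=> /imsetP[x _ ->] ->.
move=> j; have [jI|jI] := boolP (j \in I).
  apply: faces_sub (implyP (Ltau j) jI) _; apply/subsetP => x; rewrite inE.
  move=> /bigcupP[j' j'I /imsetP[y yt /eqP]].
  rewrite -tag_eqE /tag_eq /= => /andP[/eqP jj']; case: _ / jj' y yt => y yt.
  by rewrite tagged_asE => /eqP ->.
apply: faces_sub (faces0 (L j)) _; apply/subsetP => x; rewrite inE.
by move=> /bigcupP[j' j'I /imsetP[y yt [jj' _]]]; rewrite jj' j'I in jI.
Qed.

Lemma mem_substitution (s : {set V}) :
  [set tag v | v in s] \in faces K ->
  (forall j, [set x | vertex (x : 'I_(d j)) \in s] \in faces (L j)) ->
  s \in faces (substitution K L).
Proof.
move=> sK sL; rewrite inE; apply/existsP; exists [set tag v | v in s].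
rewrite sK /=; apply/existsP.
exists [ffun j => [set x | vertex (x : 'I_(d j)) \in s]].
apply/andP; split; first by apply/forallP => j; rewrite ffunE sL implybT.
apply/eqP/setP => v; apply/idP/bigcupP => [vs|[j _ /imsetP[x]]]; last first.
  by rewrite ffunE inE => xs ->.
exists (tag v); first exact: imset_f.
by case: v vs => j x vs; apply/imsetP; exists x; rewrite ?ffunE ?inE.
Qed.

(** * Splitting a simplex at [i], and the product cocycle *)

Definition inner (v : V) : option 'I_(d i) := [pick x | vertex x == v].
Definition outer (v : V) : option 'I_m := if tag v == i then None else Some (tag v).

Lemma inner_vertex (x : 'I_(d i)) : inner (vertex x) = Some x.
Proof.
rewrite /inner; case: pickP => [y|/(_ x)]; last by rewrite eqxx.
by rewrite -tag_eqE /tag_eq /= eqxx tagged_asE => /eqP ->.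
Qed.

Lemma outer_vertex (x : 'I_(d i)) : outer (vertex x) = None.
Proof. by rewrite /outer /= eqxx. Qed.

Lemma innerP (v : V) (x : 'I_(d i)) : inner v = Some x -> v = vertex x.
Proof. by rewrite /inner; case: pickP => // y /eqP <- [->]. Qed.

Lemma inner_outer (v : V) : isSome (inner v) = ~~ isSome (outer v).
Proof.
case: v => j x; rewrite /outer /=; case: eqP => [jE|ji] /=.
  by case: _ / (esym jE) x => x; rewrite inner_vertex.
by case E: inner => //; move: (innerP E) => [].
Qed.

Lemma inner_face (s : seq V) :
  [set v in s] \in faces (substitution K L) ->
  [set x in pmap inner s] \in faces (L i).
Proof.
move=> /substitutionP[_ /(_ i) sL]; apply: faces_sub sL _.
apply/subsetP => x; rewrite !inE mem_pmap => /mapP[v vs /esym/innerP vx].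
by rewrite -vx.
Qed.

(** A nonempty inner part supplies a vertex of tag [i], so [i] and the outer tags together span a
    simplex of [K]. *)
Lemma outer_face (s : seq V) :
  [set v in s] \in faces (substitution K L) -> pmap inner s != [::] ->
  [set j in pmap outer s] \in link K i.
Proof.
move=> /substitutionP[sK _] sn.
have [v vs vi] : exists2 v, v \in s & tag v = i.
  case E: (pmap inner s) sn => [|x u] // _.
  have : x \in pmap inner s by rewrite E mem_head.
  by rewrite mem_pmap => /mapP[v vs /esym/innerP vx]; exists v; rewrite // vx.
have out j : j \in pmap outer s -> j \in [set tag v | v in [set v in s]] /\ j != i.
  rewrite mem_pmap => /mapP[w ws]; rewrite /outer; case: eqP => // wi [->].
  by split; [apply: imset_f; rewrite inE|apply/eqP].
have sub : i |: [set j in pmap outer s] \subset [set tag v | v in [set v in s]].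
  apply/subsetP => j; rewrite !inE => /predU1P[->|/out[] //].
  by apply/imsetP; exists v; rewrite ?inE.
rewrite inE (faces_sub sK sub) (faces_sub sK) ?(subset_trans (subsetUr _ _) sub) //.
by rewrite !inE andbT; apply/negP => /out[_]; rewrite eqxx.
Qed.

(* The ordered cochain that reads a tuple of vertices, in whatever way the two
   kinds are interleaved, as its part in [L i] followed by the tags of the rest. *)
Definition join_cochain (k l h : nat) (x : cochain (faces (L i)) k)
    (c : cochain (link K i) l) : cochain (faces (substitution K L)) h :=
  [ffun t => ev x (pmap inner (val (val t))) * ev c (pmap outer (val (val t)))].

(** If the length of [s] is not [h], both sides vanish: the lengths of the two parts add up to that
    of [s], so they are not [k] and [l]. *)
Lemma ev_join (k l h : nat) (x : cochain (faces (L i)) k)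
    (c : cochain (link K i) l) (s : seq V) :
  h = (k + l)%N -> [set v in s] \in faces (substitution K L) ->
  ev (join_cochain h x c) s = ev x (pmap inner s) * ev c (pmap outer s).
Proof.
move=> hkl sX; have [sh|sh] := eqVneq (size s) h.
  exact: (ev_ffun (fun s => ev x (pmap inner s) * ev c (pmap outer s))).
rewrite (ev_size _ sh); apply/esym/eqP; apply: contraNT sh.
rewrite mulf_eq0 negb_or => /andP[nx nc]; rewrite hkl.
rewrite -(size_unshuffle s inner_outer); apply/eqP; congr (_ + _)%N; apply/eqP.
  by apply: contraNT nx => /ev_size ->.
by apply: contraNT nc => /ev_size ->.
Qed.

Lemma delta_join (k l h : nat) (x : cochain (faces (L i)) k)
    (c : cochain (link K i) l) :
  (0 < k)%N -> delta x = 0 -> delta c = 0 -> delta (join_cochain h x c) = 0.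
Proof.
move=> k0 dx dc; apply: cochainP => s sh sX; rewrite ev0 ev_delta //.
rewrite (dif_ev_ffun (@faces_sub _ (substitution K L))
           (fun s => ev x (pmap inner s) * ev c (pmap outer s)) sh sX).
rewrite dif_unshuffle; last exact: inner_outer.
rewrite (dif_ev_cocycle dx (inner_face sX)) mul0r add0r.
(* Without a vertex of tag [i] the outer part need not lie in the link; but then [ev x [::]] is 0
   because [k > 0]. *)
have [->|sn] := eqVneq (pmap inner s) [::].
  by rewrite ev_size ?mul0r // eq_sym -lt0n.
by rewrite (dif_ev_cocycle dc (outer_face sX sn)) mulr0.
Qed.

(** * Steenrod squares on joins inside the substitution complex *)

Variable x0 : forall j, 'I_(d j).
Hypothesis x0L : forall j, [set x0 j] \in faces (L j).

(** The chosen vertices [x0 j] lift the link along the projection to tags. *)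
Definition join (s : seq 'I_(d i)) (t : seq 'I_m) : seq V :=
  [seq vertex x | x <- s] ++ [seq vertex (x0 j) | j <- t].

Lemma link_neq (t : seq 'I_m) : [set j in t] \in link K i -> i \notin t.
Proof. by rewrite inE => /andP[/andP[_]]; rewrite inE. Qed.

(** The fibre over [i] comes from [s] alone, since [i] is not in [t]; every other fibre is contained
    in [[set x0 j]]. *)
Lemma join_face (s : seq 'I_(d i)) (t : seq 'I_m) :
  [set x in s] \in faces (L i) -> [set j in t] \in link K i ->
  [set v in join s t] \in faces (substitution K L).
Proof.
move=> sL tK; have it := link_neq tK; apply: mem_substitution.
  move: tK; rewrite inE => /andP[_ iK]; apply: faces_sub iK _; apply/subsetP => j.
  move=> /imsetP[v]; rewrite inE mem_cat => /orP[] /mapP[y ys ->] -> /=.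
    by rewrite !inE eqxx.
  by rewrite !inE ys orbT.
move=> j; have [ji|ji] := eqVneq j i.
  case: _ / (esym ji) => {ji j}; apply: faces_sub sL _; apply/subsetP => x.
  rewrite !inE mem_cat => /orP[] /mapP[y ys].
    by move=> /(congr1 inner); rewrite !inner_vertex => -[->].
  by move=> [iy _]; rewrite iy ys in it.
apply: faces_sub (x0L j) _; apply/subsetP => x.
rewrite !inE mem_cat => /orP[] /mapP[y ys].
  by move=> [jE _]; rewrite jE eqxx in ji.
move=> /eqP; rewrite -tag_eqE /tag_eq /= => /andP[/eqP jy].
by case: _ / jy; rewrite tagged_asE.
Qed.

Lemma inner_join (s : seq 'I_(d i)) (t : seq 'I_m) :
  i \notin t -> pmap inner (join s t) = s.
Proof.
move=> it; rewrite pmap_cat [X in X ++ _](_ : _ = s); last first.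
  by elim: s => //= x s ->; rewrite inner_vertex.
rewrite [X in _ ++ X](_ : _ = [::]) ?cats0 //.
elim: t it => //= j t IH; rewrite inE negb_or => /andP[ij /IH ->].
have := inner_outer (vertex (x0 j)); rewrite /outer /= eq_sym (negPf ij) /=.
by case: inner.
Qed.

Lemma outer_join (s : seq 'I_(d i)) (t : seq 'I_m) :
  i \notin t -> pmap outer (join s t) = t.
Proof.
move=> it; rewrite pmap_cat [X in X ++ _](_ : _ = [::]); last first.
  by elim: s => //= x s ->; rewrite outer_vertex.
elim: t it => //= j t IH; rewrite inE negb_or => /andP[ij /IH /= ->].
by rewrite /outer /= eq_sym (negPf ij).
Qed.

Lemma mask_join (m1 m2 : bitseq) (s : seq 'I_(d i)) (t : seq 'I_m) :
  size m1 = size s -> mask (m1 ++ m2) (join s t) = join (mask m1 s) (mask m2 t).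
Proof. by move=> ms; rewrite mask_cat ?size_map // -!map_mask. Qed.

Lemma ev_join_join (k l h : nat) (x : cochain (faces (L i)) k)
    (c : cochain (link K i) l) (s : seq 'I_(d i)) (t : seq 'I_m) :
  h = (k + l)%N -> [set x in s] \in faces (L i) -> [set j in t] \in link K i ->
  ev (join_cochain h x c) (join s t) = ev x s * ev c t.
Proof.
move=> hkl sL tK; rewrite ev_join //; last exact: join_face.
by have it := link_neq tK; rewrite inner_join // outer_join.
Qed.

(** The cup index rises by [l], from [q - n] to [q + l - n]. In a nonzero term J contains all [l]
    positions of [t], which accounts exactly for the rise; what remains is the sum for [sq n x]. *)
Lemma ev_sq_join (q n l : nat) (x : cochain (faces (L i)) q.+1)
    (c : cochain (link K i) l) (s : seq 'I_(d i)) (t : seq 'I_m) :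
  (n <= q)%N -> size s = (q + n).+1 -> [set y in s] \in faces (L i) ->
  size t = l -> [set j in t] \in link K i ->
  ev (sq n (join_cochain (q + l).+1 x c)) (join s t) = ev (sq n x) s * ev c t.
Proof.
move=> nq ss sL st tK; rewrite /sq nq (leq_trans nq (leq_addr _ _)).
have sX := join_face sL tK.
have sz : size (join s t) = (q + l + n).+1.
  by rewrite size_cat !size_map ss st addSn addnAC.
have hql : (q + l).+1 = (q.+1 + l)%N by [].
have subL m1 : [set y in mask m1 s] \in faces (L i).
  apply: faces_sub sL _; apply/subsetP => y; rewrite !inE; exact: mem_mask.
have subK m2 : [set j in mask m2 t] \in link K i.
  by apply: link_sub tK _; apply/subsetP => j; rewrite !inE; apply: mem_mask.
rewrite (ev_cup _ _ _ sz sX) (ev_cup _ _ _ ss sL) big_distrl /=.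
have -> : (q + l + n).+1 = ((q + n).+1 + l)%N by rewrite addSn addnAC.
rewrite (perm_big _ (masks_cat _ _)) big_mkcond big_allpairs_dep /= [RHS]big_mkcond /=.
rewrite big_seq [RHS]big_seq; apply: eq_bigr => m1; rewrite mem_masks => /eqP m1s.
have szm b : size (cut_mask false b m1) = size s by rewrite size_cut_mask m1s ss.
have nl : nseq l true \in masks l by rewrite mem_masks size_nseq.
rewrite (bigD1_seq _ nl (masks_uniq l)) /= big_seq_cond big1 ?addr0; last first.
  (* A nonzero term needs all of [t] in both subtuples, which overlap in J: so J
     contains every position of [t]. *)
  move=> m2; rewrite mem_masks => /andP[/eqP m2s m2n]; case: ifP => // _.
  rewrite !cut_mask_cat !mask_join // !(ev_join_join _ _ hql) //.
  apply/eqP; apply: contraR m2n; rewrite !mulf_eq0 !negb_or.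
  set p := false (+) _ => /andP[/andP[_ c1] /andP[_ c2]].
  have full b : ev c (mask (cut_mask p b m2) t) != 0 -> all id (cut_mask p b m2).
    move=> cb; rewrite all_count size_cut_mask m2s -(@size_mask _ _ t).
      by apply: contraNT cb => /ev_size ->.
    by rewrite size_cut_mask m2s st.
  rewrite -m2s; apply/eqP/all_pred1P.
  apply: sub_all (cut_maskI (full _ c1) (full _ c2)).
  by case.
(* The positions of [t] use up [l] elements of J, leaving [(q - n).+1] among the positions of
   [s]. *)
rewrite count_cat count_nseq mul1n -addnBAC // -addSn eqn_add2r.
case: ifP => // _; rewrite !cut_mask_cat !mask_join // !(ev_join_join _ _ hql) //.
rewrite !cut_mask_nseq mask_true ?st // mulrACA; congr (_ * _).
(* Both subtuples contain [t], and [ev c t] equals its square in F_2. *)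
by case: (ev c t) => [[|[|]]] // ?; apply: val_inj.
Qed.

(** Since [n > 0], both squares lie in positive degree, where [coboundary_dif] applies. The case
    [l = 0] is included and serves for reduced cohomology in degree -1. *)
Lemma nontrivial_sq_join (n l : nat) (c : cochain (link K i) l)
    (eta : {scalar {ffun osimplex (link K i) l -> ('F_2)^o}}) :
  (0 < n)%N -> delta c = 0 -> eta c = 1 ->
  (forall g : seq 'I_m -> 'F_2, eta [ffun t => dif g (val (val t))] = 0) ->
  has_nontrivial_sq (faces (L i)) n ->
  has_nontrivial_sq (faces (substitution K L)) n.
Proof.
move=> n0 dc etac eta0 [q [x [dx nx]]].
have pos r : (0 < r + n)%N by rewrite addn_gt0 n0 orbT.
(* For [n > q] the cochain [sq n x] is 0 by definition, hence a coboundary, contrary to [nx]. *)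
have [nq|qn] := leqP n q; last first.
  case: nx; apply/(coboundary_dif (@faces_sub _ (L i))) => //.
  exists (fun=> 0) => s _ _; rewrite /sq leqNgt qn ev0.
  by rewrite dif_eq0.
(* As [c] takes [l] vertices, the product takes [q.+1 + l] of them and has degree [q + l]. *)
exists (q + l)%N, (join_cochain (q + l).+1 x c); split; first exact: delta_join.
move=> /(coboundary_dif (@faces_sub _ (substitution K L)) _ (pos _))[f sqf].
apply: nx; apply/(coboundary_dif (@faces_sub _ (L i))) => //.
apply: (slant_coboundary (f := fun s t => f (join s t)) eta0 etac) => s t ss sL st tK.
rewrite -ev_sq_join // sqf; last exact: join_face; last first.
  by rewrite size_cat !size_map ss st addSn addnAC.
by rewrite dif_cat !dif_map.
Qed.

End Propagation.

Theorem proposition6p3p2 (m : nat) (d : 'I_m -> nat)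
    (K : scomplex 'I_m) (L : forall j : 'I_m, scomplex 'I_(d j))
    (hL : forall j : 'I_m, exists x : 'I_(d j), [set x] \in faces (L j))
    (i : 'I_m) (n : nat) (hn : (1 <= n)%N) :
  has_nontrivial_sq (faces (L i)) n ->
  ~ acyclic (link K i) ->
  has_nontrivial_sq (faces (substitution K L)) n.
Proof.
(* By contraposition: if the substitution complex has no nontrivial Sq^n, every reduced cocycle of
   the link is a coboundary. *)
move=> Lsq nacyclic; apply: NNPP => Ssq; apply: nacyclic.
pose x0 j := xchoose (hL j); have x0L j : [set x0 j] \in faces (L j) := xchooseP (hL j).
split=> [c dc|l c dc].
  (* In degree -1 only 0 is a coboundary, so [c] is separated from the zero subspace; [dif g]
     vanishes on the empty tuple. *)
  have [//|c0] := eqVneq c 0; case: Ssq.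
  have [|eta [eta0 etac]] := @separating_functional _ 0%VS c; first by rewrite memv0.
  apply: (nontrivial_sq_join x0L hn dc etac _ Lsq) => g.
  rewrite -[RHS](linear0 eta); congr (eta _).
  by apply/ffunP => t; rewrite !ffunE tuple0.
have [//|nw] := classic (exists w, c = delta w); case: Ssq.
pose D : {linear {ffun osimplex (link K i) l -> ('F_2)^o} ->
    {ffun osimplex (link K i) l.+1 -> ('F_2)^o}} :=
  HB.pack (@delta _ (link K i) l)
    (GRing.isLinear.Build _ _ _ _ _ (@delta_is_linear _ (link K i) l)).
have cD : (c : {ffun _ -> ('F_2)^o}) \notin limg (linfun D).
  by apply/memv_imgP => -[w _ cw]; case: nw; exists w; rewrite cw lfunE.
have [eta [eta0 etac]] := separating_functional cD.
apply: (nontrivial_sq_join x0L hn dc etac _ Lsq) => g.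
(* On simplices of the link, [dif g] is the coboundary of the restriction of [g], so it lies in the
   image of [D]. *)
rewrite -(eta0 (D [ffun t => g (val (val t))])); last first.
  by rewrite -[D _]lfunE memv_img ?memvf.
congr (eta _); apply/ffunP => t; rewrite ffunE -[RHS]ev_val.
by rewrite ev_delta ?(dif_ev_ffun (@link_sub _ K i)) ?size_tuple //; apply: (valP t).
Qed.
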